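(* Let $\mathcal X$ be a finite set and let $\mathcal C$ be an arbitrary nonempty set of probability measures on $(\mathcal X^\infty,\mathcal F)$ (no measurability or other structure is assumed on $\mathcal C$). Then there exist a sequence of measures $\mu_k\in\mathcal C$, $k\in\mathbb N$, and a sequence of real weights $v_k>0$, $k\in\mathbb N$, with $\sum_{k\in\mathbb N}v_k=1$, such that the measure $\phi:=\sum_{k\in\mathbb N}v_k\mu_k$ satisfies $$D(\mathcal C,\phi)=V_{\mathcal C}.$$ Moreover, for every probability measure $\rho$ on $(\mathcal X^\infty,\mathcal F)$ there exists a measure $\phi$ of the same form (that is, $\phi=\sum_{k\in\mathbb N}v_k\mu_k$ for some $\mu_k\in\mathcal C$ and some real $v_k>0$ with $\sum_{k\in\mathbb N}v_k=1$) such that $D(\mu,\phi)\le D(\mu,\rho)$ for all $\mu\in\mathcal C$.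
   Context: $\mathcal X$ is a finite set, $\mathcal X^\infty$ is the set of one-way infinite sequences over $\mathcal X$, and $\mathcal F$ is the usual Borel sigma-field on $\mathcal X^\infty$ (generated by the cylinder sets). $\mathcal P$ denotes the set of all probability measures on $(\mathcal X^\infty,\mathcal F)$; its elements are also called predictors. $x_{1..n}$ denotes $x_1,\dots,x_n$, and for $\mu\in\mathcal P$, $\mu(x_{1..n})$ is the $\mu$-probability of the set of infinite sequences starting with $x_{1..n}$. $\mathbb N$ is the set of positive integers. Logarithms are to base 2. For $\mu,\rho\in\mathcal P$ and $n\in\mathbb N$ the expected cumulative Kullback-Leibler divergence is $$d_n(\mu,\rho):=\sum_{x_{1..n}\in\mathcal X^n}\mu(x_{1..n})\log\frac{\mu(x_{1..n})}{\rho(x_{1..n})}\in[0,+\infty],$$ with the usual conventions (terms with $\mu(x_{1..n})=0$ are $0$; terms with $\mu(x_{1..n})>0=\rho(x_{1..n})$ are $+\infty$). The asymptotic average KL loss of $\rho$ on $\mu$ is $$D(\mu,\rho):=\limsup_{n\to\infty}\frac1n d_n(\mu,\rho).$$ For a set $\mathcal C\subseteq\mathcal P$ define $D(\mathcal C,\rho):=\sup_{\mu\in\mathcal C}D(\mu,\rho)$ and the minimax loss $$V_{\mathcal C}:=\inf_{\rho\in\mathcal P}D(\mathcal C,\rho)=\inf_{\rho\in\mathcal P}\sup_{\mu\in\mathcal C}D(\mu,\rho).$$ *)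

(* Defs.v *)
From HB Require Import structures.
From mathcomp Require Import all_boot all_order all_algebra.
From mathcomp Require Import all_classical all_reals all_analysis.

Set Implicit Arguments.
Unset Strict Implicit.
Unset Printing Implicit Defensive.

Import Order.TTheory GRing.Theory Num.Theory.

Local Open Scope classical_set_scope.
Local Open Scope ring_scope.
Local Open Scope ereal_scope.

(* The set of one-way infinite sequences over X.  The library requires
   measurable spaces to be pointed, hence the (otherwise unused) letter x0: if X
   is empty there is no infinite sequence and no probability measure at all. *)
Definition infseq (X : finType) (x0 : X) : Type := nat -> X.

HB.instance Definition _ (X : finType) (x0 : X) := Choice.on (infseq x0).
HB.instance Definition _ (X : finType) (x0 : X) :=
  isPointed.Build (infseq x0) (fun=> x0).

(* The infinite sequences starting with the word x; positions are counted
   from 0, so x_1, ..., x_n are the values of w at 0, ..., n - 1. *)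
Definition cylinder (X : finType) (x0 : X) (n : nat) (x : n.-tuple X) :
    set (infseq x0) :=
  [set w | forall i : 'I_n, w i = tnth x i].
Arguments cylinder {X} x0 {n} x.

Definition cylinders (X : finType) (x0 : X) : set (set (infseq x0)) :=
  [set A | exists (n : nat) (x : n.-tuple X), A = cylinder x0 x].

Definition seqspace (X : finType) (x0 : X) :=
  g_sigma_algebraType (@cylinders X x0).

(* Elements of `probability` are functions on all sets, but they are constrained,
   and hence should be compared, on measurable sets only. *)
Definition predictor (R : realType) (X : finType) (x0 : X) :=
  probability (seqspace x0) R.

Section KL_loss.
Context (R : realType) (X : finType) (x0 : X).
Implicit Types (mu rho phi : predictor R x0) (C : set (predictor R x0)).

Definition word_prob mu n (x : n.-tuple X) : R := fine (mu (cylinder x0 x)).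

Definition log2 (r : R) : R := (ln r / ln 2)%R.

Definition kl_term (p q : R) : \bar R :=
  if p == 0%R then 0
  else if q == 0%R then +oo
  else (p * log2 (p / q))%:E.

Definition kl_div n mu rho : \bar R :=
  \sum_(x : n.-tuple X) kl_term (word_prob mu x) (word_prob rho x).

(* The term of index n = 0 is irrelevant for the limit superior. *)
Definition loss mu rho : \bar R :=
  limn_esup (fun n => (n%:R^-1)%:E * kl_div n mu rho).

Definition sup_loss C rho : \bar R := ereal_sup [set loss mu rho | mu in C].

Definition minimax_loss C : \bar R :=
  ereal_inf [set sup_loss C rho | rho in [set: predictor R x0]].

Definition discrete_mixture C phi : Prop :=
  exists (mu_ : nat -> predictor R x0) (v : nat -> R),
    [/\ forall k, C (mu_ k),
        forall k, (0 < v k)%R,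
        \sum_(0 <= k <oo) (v k)%:E = 1 &
        forall A : set (seqspace x0), measurable A ->
          phi A = \sum_(0 <= k <oo) (v k)%:E * mu_ k A].

End KL_loss.

(* Main.v *)
Require Import Defs.
From mathcomp Require Import all_boot all_order all_algebra.
From mathcomp Require Import all_classical all_reals all_analysis.
From mathcomp Require Import ring lra.

Set Implicit Arguments.
Unset Strict Implicit.
Unset Printing Implicit Defensive.

Import Order.TTheory GRing.Theory Num.Theory.
Import numFieldNormedType.Exports.

Local Open Scope classical_set_scope.
Local Open Scope ring_scope.
Local Open Scope ereal_scope.

(** The heart of the proof is an exact optimality condition for mixtures over
words of one fixed length [n]. Write [rho], [mu], [k] for the distributions
induced on the words of length [n]. If [k] maximizes
[\sum_x rho x * ln (k x)] over the mixtures of elements of [C] (it is then the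
reverse information projection of [rho] onto their convex hull), moving from [k]
towards any [mu] in [C] cannot increase this concave functional. Hence the
first-order gain is nonpositive, which reads
  [\sum_x mu x * rho x / k x <= 1] for all [mu] in [C].
By Jensen's inequality the left-hand side bounds the exponential of the
[mu]-average of [ln (rho x / k x)], so that [k] loses nothing against [rho],
uniformly over [C].

The supremum is not attained in general, but a near-maximizer does as well up to
a constant factor ([near_projection]); a bound [a] on the ratio sum costs only
[log2 a] in divergence ([kl_sum_le]).

This gives a mixture [phi_n] for every length [n]. The mixture
[phi = \sum_n w_n * phi_n], with [w_n = 1 / ((n + 1) * (n + 2))], satisfies
[phi >= w_n * phi_n], so the ratio sum at length [n] is at most [7 / w_n], whose
logarithm is negligible against [n]. A countable mixture of countable
mixtures is again one, hence [phi] has the required form and dominates [rho] on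
all of [C] ([mixture_dominates]).

Finally the infimum defining the minimax loss is attained: against each member
of a minimizing sequence, the mixture of the whole sequence loses only a bounded
amount of divergence ([minimax_attained]). A mixture of elements of [C]
dominating that optimal predictor is then optimal too. *)

(** * Reverse information projection on a finite set *)

(** The first-order lower bound on the gain of moving from [k] to
[(1 - t) * k + t * c] at a point where [c / k = r]. The slope [r / 2] instead of
[r] leaves room for the concavity of [ln] as long as [t * r <= 1]. *)
Lemma ln_mixture_ge (R : realType) (t r : R) :
  (0 < t -> t <= 1 / 2 -> 0 <= r -> t * r <= 1 ->
   t * (r - 5) / 2 <= ln (1 - t + t * r))%R.
Proof.
move=> t0 t2 r0 tr1; set y := (1 - t + t * r)%R.
have y12 : (1 / 2 <= y)%R by rewrite /y; have := mulr_ge0 (ltW t0) r0; lra.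
have y0 : (0 < y)%R by lra.
have lny : (1 - y^-1 <= ln y)%R.
  have := @le_ln1Dx R (y^-1 - 1)%R; rewrite addrCA subrr addr0 lnV ?posrE//.
  have yV0 : (0 < y^-1)%R by rewrite invr_gt0.
  by move=> /(_ ltac:(lra)); lra.
apply: le_trans lny.
have -> : (1 - y^-1 = t * (r - 1) / y)%R.
  have yE : (t * (r - 1) = y - 1)%R by rewrite /y; ring.
  by rewrite yE mulrBl divff ?gt_eqF// mul1r.
rewrite ler_pdivlMr// mulrAC ler_pdivrMr// -!mulrA ler_pM2l//.
have [r5|r5] := leP 5%R r; last by nra.
have y2 : (y <= 2)%R by rewrite /y; lra.
by nra.
Qed.

(** The bound is obtained from a near-maximizer [k] of
[F k = \sum_x rho x * ln (k x)]. All terms of [F] are nonpositive, so a value of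
[F k] within 1 of the supremum keeps each [k x] with [0 < rho x] above a
constant [B^-1] that does not depend on [k]. A step [t] of order [B^-1] towards
[c] then stays in the range of [ln_mixture_ge], and it gains at most [t] as soon
as [k] is [t]-optimal. For [F] to be finite somewhere, each point charged by
[rho] has to be charged by some element of [C]. *)
Lemma near_projection_full (R : realType) (T : finType) (K C : set (T -> R))
    (rho : T -> R) :
  (forall x, 0 <= rho x)%R -> (\sum_x rho x <= 1)%R ->
  (forall x, 0 < rho x -> exists2 c, C c & 0 < c x)%R ->
  K !=set0 ->
  (forall k x, K k -> 0 <= k x <= 1)%R ->
  (forall c x, C c -> 0 <= c x <= 1)%R ->
  (forall k c t, K k -> C c -> 0 < t -> t < 1 ->
     K (fun x => (1 - t) * k x + t * c x))%R ->
  exists k, [/\ K k,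
    forall x, (0 < rho x -> 0 < k x)%R &
    forall c, C c -> (\sum_x c x * rho x / k x <= 7)%R].
Proof.
move=> rho0 rho1 rhoC [k0 Kk0] K01 C01 Kconv.
have kcpos k c t x : K k -> C c -> (0 < t -> t < 1 ->
    (0 < k x) || (0 < c x) -> 0 < (1 - t) * k x + t * c x)%R.
  move=> Kk Cc t0 t1.
  have /andP[k_ge0 _] := K01 _ x Kk; have /andP[c_ge0 _] := C01 _ x Cc.
  have t1' : (0 < 1 - t)%R by lra.
  by case/orP => h; [apply: ltr_wpDr|apply: ltr_wpDl];
    rewrite ?mulr_gt0 ?mulr_ge0// ltW.
(* Averaging with one charging [c] per point makes [F] finite. *)
have [k1 Kk1 k1pos] : exists2 k, K k & forall x, (0 < rho x -> 0 < k x)%R.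
  suff [k Kk kpos] : exists2 k, K k &
      forall x, x \in enum T -> (0 < rho x -> 0 < k x)%R.
    by exists k => // x; apply: kpos; rewrite mem_enum.
  elim: (enum T) => [|y s [k Kk IH]]; first by exists k0.
  have [rhoy|nSy] := ltP 0%R (rho y); last first.
    exists k => // x; rewrite inE => /predU1P[->|]; last exact: IH.
    by rewrite ltNge nSy.
  have [c Cc cy] := rhoC _ rhoy.
  exists (fun x => (1 - 1 / 2) * k x + 1 / 2 * c x)%R.
    by apply: Kconv => //; lra.
  move=> x; rewrite inE => /predU1P[->|xs] Sx; apply: kcpos;
    rewrite ?cy ?orbT//; try lra.
  by rewrite IH.
pose F k := (\sum_x rho x * ln (k x))%R.
(* As [ln] is 0 on nonpositive numbers, positivity has to be required. *)
pose E := [set F k | k in [set k | K k /\ forall x, (0 < rho x -> 0 < k x)%R]].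
have term_le0 k x : K k -> (rho x * ln (k x) <= 0)%R.
  by move=> Kk; rewrite mulr_ge0_le0// ln_le0//; case/andP: (K01 _ x Kk).
have supE : has_sup E.
  split; first by exists (F k1), k1.
  exists 0%R => _ [k [Kk _] <-].
  by rewrite -oppr_ge0 -sumrN; apply: sumr_ge0 => x _;
    rewrite oppr_ge0 term_le0.
set M := sup E.
pose b x := expR (- ((M - 1) / rho x)).
pose B := (1 + \sum_x b x)%R.
have B1 : (1 <= B)%R by rewrite lerDl sumr_ge0// => x _; exact: expR_ge0.
have bB x : (b x <= B)%R.
  rewrite /B (bigD1 x)//= addrCA lerDl addr_ge0// sumr_ge0// => y _.
  exact: expR_ge0.
(* This [t] serves both as the step size and as the optimality gap. *)
pose t := ((2 * B)^-1)%R.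
have B0 : (0 < B)%R by lra.
have t0 : (0 < t)%R by rewrite invr_gt0; lra.
have tB : (t * B = 1 / 2)%R by rewrite /t; field; lra.
have t2 : (t <= 1 / 2)%R by rewrite -tB ler_peMr// ltW.
have [_ [k [Kk kpos] <-] Fk] := sup_adherent t0 supE; rewrite -/M in Fk.
have kB x : (0 < rho x -> (k x)^-1 <= B)%R.
  move=> rx; apply: le_trans (bB x).
  rewrite /b expRN lef_pV2 ?posrE ?expR_gt0 ?kpos//.
  rewrite -[leRHS](@lnK _ (k x)) ?posrE ?kpos// ler_expR ler_pdivrMr// mulrC.
  apply: (@le_trans _ _ (F k)); first by lra.
  rewrite /F (bigD1 x)//= gerDl -oppr_ge0 -sumrN.
  by apply: sumr_ge0 => y _; rewrite oppr_ge0 term_le0.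
exists k; split=> // c Cc.
pose k' x := ((1 - t) * k x + t * c x)%R.
have Fk' : (F k' <= M)%R.
  apply: ub_le_sup; first exact: supE.2.
  exists k' => //; split; first by apply: Kconv => //; lra.
  by move=> x rx; apply: kcpos => //; rewrite ?kpos//; lra.
have key : (\sum_x (t * (c x * rho x / k x - 5 * rho x) / 2) <= F k' - F k)%R.
  rewrite /F -sumrB; apply: ler_sum => x _.
  have [rx|] := ltP 0%R (rho x); last first.
    move=> rx; have -> : rho x = 0%R by apply/eqP; rewrite eq_le rx rho0.
    by rewrite !(mulr0, mul0r) !subrr mulr0 mul0r.
  have kx := kpos _ rx; have /andP[c_ge0 c_le1] := C01 _ x Cc.
  have r0 : (0 <= c x / k x)%R by rewrite divr_ge0// ltW.
  have rB : (c x / k x <= B)%R.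
    by rewrite -[leRHS]mul1r ler_pM ?invr_ge0 ?kB// ltW.
  have := @ln_mixture_ge _ t (c x / k x)%R t0 t2 r0.
  have -> : (1 - t + t * (c x / k x) = k' x / k x)%R by rewrite /k'; field; lra.
  have k'x : (0 < k' x)%R by apply: kcpos => //; rewrite ?kx//; lra.
  rewrite ln_div ?posrE// => /(_ ltac:(nra)) /(ler_wpM2l (ltW rx)).
  rewrite -mulrBr; congr (_ <= _)%R.
  by field; lra.
rewrite -mulr_suml -mulr_sumr sumrB -mulr_sumr in key.
set A := (\sum_x _)%R in key *; set r := (\sum_x _)%R in key rho1.
(* [A < 2 + 5 * r], where the mass [r] of [rho] is at most 1; hence 7. *)
have : (t * (A - 5 * r) / 2 < t)%R by lra.
rewrite -mulrA gtr_pMr// => h; lra.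
Qed.

(** Points charged by no element of [C] contribute nothing to the sums in the
conclusion, so [rho] may be restricted to the other points, which only
decreases its total mass. *)
Lemma near_projection (R : realType) (T : finType) (K C : set (T -> R))
    (rho : T -> R) :
  (forall x, 0 <= rho x)%R -> (\sum_x rho x <= 1)%R ->
  K !=set0 ->
  (forall k x, K k -> 0 <= k x <= 1)%R ->
  (forall c x, C c -> 0 <= c x <= 1)%R ->
  (forall k c t, K k -> C c -> 0 < t -> t < 1 ->
     K (fun x => (1 - t) * k x + t * c x))%R ->
  exists k, [/\ K k,
    forall c x, C c -> (0 < c x -> 0 < rho x -> 0 < k x)%R &
    forall c, C c -> (\sum_x c x * rho x / k x <= 7)%R].
Proof.
move=> rho0 rho1 K0 K01 C01 Kconv.
pose S x := `[< exists2 c, C c & (0 < c x)%R >].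
pose rhoS x := if S x then rho x else 0%R.
have rhoS0 x : (0 <= rhoS x)%R by rewrite /rhoS; case: ifP.
have rhoS1 : (\sum_x rhoS x <= 1)%R.
  by apply: le_trans rho1; apply: ler_sum => x _; rewrite /rhoS; case: ifP.
have rhoSC x : (0 < rhoS x -> exists2 c, C c & 0 < c x)%R.
  by rewrite /rhoS; case: ifPn => [/asboolP//|_]; rewrite ltxx.
have [k [Kk kpos kle]] :=
  near_projection_full rhoS0 rhoS1 rhoSC K0 K01 C01 Kconv.
have SC c x : C c -> (0 < c x)%R -> S x.
  by move=> Cc cx; apply/asboolP; exists c.
exists k; split=> // [c x Cc cx rx|c Cc].
  by apply: kpos; rewrite /rhoS (SC c).
rewrite (eq_bigr (fun x => c x * rhoS x / k x)%R) ?kle// => x _.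
have /andP[c_ge0 _] := C01 _ x Cc.
have [cx|cx] := ltP 0%R (c x); first by rewrite /rhoS (SC c).
have -> : c x = 0%R by apply/eqP; rewrite eq_le cx.
by rewrite !mul0r.
Qed.

(** Jensen's inequality for the [p]-average of [ln (q / r)], in tangent form:
[ln y <= y / a - 1 + ln a]. If [q] misses a point charged by [p], the right-hand
side is infinite. *)
Lemma kl_sum_le (R : realType) (T : finType) (p q r : T -> R) (a : R) :
  (forall x, 0 <= p x)%R -> (\sum_x p x = 1)%R ->
  (forall x, 0 <= q x)%R ->
  (forall x, 0 < p x -> 0 < q x -> 0 < r x)%R ->
  (0 < a)%R -> (\sum_x p x * q x / r x <= a)%R ->
  \sum_x kl_term (p x) (r x) <= \sum_x kl_term (p x) (q x) + (log2 a)%:E.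
Proof.
move=> p0 p1 q0 r0 a0 pqr.
have ln2 : (0 < ln 2 :> R)%R by rewrite ln_gt0// ltr1n.
have [[y [py qy]]|nex] := pselect (exists y, p y != 0%R /\ q y = 0%R).
  suff -> : \sum_x kl_term (p x) (q x) = +oo by rewrite addye// leey.
  apply/eqP; rewrite esum_eqy => [|x _].
    by apply/existsP; exists y; rewrite /kl_term (negbTE py) qy eqxx.
  by rewrite /kl_term; do 2 case: ifP => // _.
have pq x : (p x != 0 -> 0 < p x /\ 0 < q x)%R.
  move=> px; rewrite !lt_def px p0 q0; split=> //; rewrite andbT.
  by apply/negP => /eqP qx; apply: nex; exists x.
have klE s : (forall x, p x != 0 -> 0 < s x)%R ->
    \sum_x kl_term (p x) (s x) = (\sum_x p x * log2 (p x / s x))%:E.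
  move=> s0; rewrite -sumEFin; apply: eq_bigr => x _; rewrite /kl_term.
  have [->|px] := eqVneq (p x) 0%R; first by rewrite mul0r.
  by rewrite gt_eqF// s0.
rewrite klE => [|x px]; last by case: (pq x px) => *; exact: r0.
rewrite klE => [|x /pq[]//]; rewrite -EFinD lee_fin -lerBlDl -sumrB.
apply: (@le_trans _ _
  (\sum_x (p x * q x / r x / a - p x + p x * ln a) / ln 2)%R).
  apply: ler_sum => x _.
  have [->|px] := eqVneq (p x) 0%R; first by rewrite !(mul0r, subrr, add0r).
  have [px0 qx0] := pq x px; have rx0 := r0 _ px0 qx0.
  have -> : (p x * log2 (p x / r x) - p x * log2 (p x / q x) =
      p x * (ln (p x / r x) - ln (p x / q x)) / ln 2)%R by rewrite /log2; ring.
  have -> : ((p x * q x / r x / a - p x + p x * ln a) / ln 2 =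
      p x * (q x / r x / a - 1 + ln a) / ln 2)%R by ring.
  rewrite ler_pM2r ?invr_gt0// ler_pM2l//.
  rewrite !ln_div ?posrE//.
  have : (ln (q x / r x / a) <= q x / r x / a - 1)%R.
    have h : (0 < q x / r x / a)%R by rewrite !divr_gt0.
    have := @le_ln1Dx R (q x / r x / a - 1)%R; rewrite addrCA subrr addr0.
    by apply; lra.
  by rewrite !ln_div ?posrE ?divr_gt0//; lra.
rewrite -mulr_suml /log2 ler_pM2r ?invr_gt0// big_split sumrB/=.
rewrite -!mulr_suml p1 mul1r.
by rewrite gerDr subr_le0 ler_pdivrMr// mul1r.
Qed.

(** * Countable mixtures of probability measures *)

(** Positive weights of total mass 1 whose logarithms grow sublinearly. Written
as a difference, their series telescopes. *)
Definition telescoping_weight {R : realType} (n : nat) : R :=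
  (n.+1%:R^-1 - n.+2%:R^-1)%R.

Lemma telescoping_weightE (R : realType) n :
  telescoping_weight n = ((n.+1 * n.+2)%:R^-1 : R)%R.
Proof.
have n1 : (n.+1%:R != 0 :> R)%R by rewrite pnatr_eq0.
have n2 : (n.+2%:R != 0 :> R)%R by rewrite pnatr_eq0.
rewrite /telescoping_weight natrM -[LHS](mulfK (mulf_neq0 n1 n2)).
by rewrite mulrBl mulKf// mulrCA mulVf// mulr1 -natrB// subSnn mul1r.
Qed.

Lemma telescoping_weight_gt0 (R : realType) n :
  (0 < telescoping_weight n :> R)%R.
Proof. by rewrite telescoping_weightE invr_gt0 ltr0n. Qed.

Lemma telescoping_weight_sum (R : realType) :
  \sum_(0 <= k <oo) (telescoping_weight k)%:E = 1 :> \bar R.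
Proof.
apply: cvg_lim => //.
rewrite (_ : (fun n => _) = (fun n => (1 - n.+1%:R^-1)%:E)); last first.
  apply/funext => n; rewrite sumEFin; congr _%:E.
  under eq_bigr do rewrite /telescoping_weight -opprB.
  by rewrite sumrN telescope_sumr// opprB invr1.
apply: cvg_EFin; first by near=> n.
rewrite -[X in _ --> X]subr0; apply: cvgB; first exact: cvg_cst.
exact: cvg_harmonic.
Unshelve. all: end_near. Qed.

Lemma mixture_exists (R : realType) d (T : measurableType d)
    (mu : nat -> probability T R) (v : nat -> R) :
  (forall k, 0 <= v k)%R -> \sum_(0 <= k <oo) (v k)%:E = 1 ->
  exists phi : probability T R,
    forall A, phi A = \sum_(0 <= k <oo) (v k)%:E * mu k A.
Proof.
move=> v0 v1.
have normK (m : {measure set T -> \bar R}) (P : probability T R) A :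
    m setT = 1 -> mnormalize m P A = m A.
  by move=> mT; rewrite /mnormalize mT onee_eq0/= invr1 mule1.
pose m := mseries (fun k => mscale (NngNum (v0 k)) (mu k)) 0.
exists (mnormalize m (mu 0%N)) => A; apply: normK.
rewrite /m /mseries -[RHS]v1; apply: eq_eseriesr => k _.
transitivity ((v k)%:E * mu k setT) => //.
by rewrite probability_setT mule1.
Qed.

Lemma nneseries_term_le (R : realType) (a : nat -> \bar R) j :
  (forall k, 0 <= a k) -> a j <= \sum_(0 <= k <oo) a k.
Proof. by move=> a0; rewrite (@nneseriesD1 _ _ j)// leeDl// nneseries_ge0. Qed.

Section mixtures.
Context (R : realType) (X : finType) (x0 : X).
Implicit Types (C : set (predictor R x0)).

(** Components and weights of the mixed mixtures are doubly indexed; a bijection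
[nat -> nat * nat] turns them into sequences. *)
Lemma discrete_mixture_mixture C phi_ (v : nat -> R) (phi : predictor R x0) :
  (forall k, discrete_mixture C (phi_ k)) ->
  (forall k, 0 < v k)%R -> \sum_(0 <= k <oo) (v k)%:E = 1 ->
  (forall A : set (seqspace x0), measurable A ->
     phi A = \sum_(0 <= k <oo) (v k)%:E * phi_ k A) ->
  discrete_mixture C phi.
Proof.
move=> mix v0 v1 phiE.
have /choice[f fP] : forall k, exists f : (nat -> predictor R x0) * (nat -> R),
    [/\ forall j, C (f.1 j), forall j, (0 < f.2 j)%R,
      \sum_(0 <= j <oo) (f.2 j)%:E = 1 &
      forall A : set (seqspace x0), measurable A ->
        phi_ k A = \sum_(0 <= j <oo) (f.2 j)%:E * f.1 j A].
  by move=> k; have [mu_ [w ?]] := mix k; exists (mu_, w).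
have /card_set_bijP[e e_bij] : ([set: nat] #= [set: nat * nat])%card.
  by rewrite card_eq_sym; exact: card_nat2.
have flatten_sum (a : nat -> nat -> \bar R) : (forall k j, 0 <= a k j) ->
    \sum_(0 <= k <oo) (v k)%:E * \sum_(0 <= j <oo) a k j =
    \sum_(0 <= i <oo) (v (e i).1)%:E * a (e i).1 (e i).2.
  move=> a0.
  have b0 k j : 0 <= (v k)%:E * a k j by rewrite mule_ge0// lee_fin ltW.
  rewrite [RHS]nneseries_esumT//.
  rewrite -(reindex_esum setT setT e (fun p => (v p.1)%:E * a p.1 p.2) e_bij).
  rewrite (_ : [set: nat * nat] = setT `*`` (fun=> setT)); last first.
    by apply/seteqP; split.
  rewrite -(@esum_esum _ _ _ setT (fun=> setT) (fun k j => (v k)%:E * a k j))//.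
  rewrite nneseries_esumT => [|k]; last first.
    rewrite mule_ge0 ?lee_fin ?(ltW (v0 k))//.
    by apply: nneseries_ge0 => j _ _; exact: a0.
  by apply: eq_esum => k _; rewrite -nneseriesZl// nneseries_esumT.
exists (fun i => (f (e i).1).1 (e i).2),
  (fun i => (v (e i).1 * (f (e i).1).2 (e i).2)%R); split.
- by move=> i; have [] := fP (e i).1.
- by move=> i; rewrite mulr_gt0//; have [] := fP (e i).1.
- under eq_eseriesr do rewrite EFinM.
  rewrite -(flatten_sum (fun k j => ((f k).2 j)%:E)).
    rewrite -[RHS]v1; apply: eq_eseriesr => k _.
    by have [_ _ -> _] := fP k; rewrite mule1.
  by move=> k j; have [_ h _ _] := fP k; rewrite lee_fin ltW.
- move=> A mA; rewrite phiE//.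
  under [RHS]eq_eseriesr do rewrite EFinM -muleA.
  rewrite -(flatten_sum (fun k j => ((f k).2 j)%:E * (f k).1 j A)).
    by apply: eq_eseriesr => k _; have [_ _ _ ->] := fP k.
  by move=> k j; have [_ h _ _] := fP k; rewrite mule_ge0// lee_fin ltW.
Qed.

Lemma telescoping_weight_average (c : \bar R) : c \is a fin_num ->
  \sum_(0 <= k <oo) (telescoping_weight k)%:E * c = c.
Proof.
case: c => [r _|//|//]; under eq_eseriesr do rewrite muleC.
rewrite nneseriesZl ?telescoping_weight_sum ?mule1// => k _.
by rewrite lee_fin ltW// telescoping_weight_gt0.
Qed.

Lemma discrete_mixture1 C mu : C mu -> discrete_mixture C mu.
Proof.
move=> Cmu; exists (fun=> mu), telescoping_weight; split=> //.
- exact: telescoping_weight_gt0.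
- exact: telescoping_weight_sum.
- by move=> A mA; rewrite telescoping_weight_average ?fin_num_measure.
Qed.

Lemma discrete_mixture_conv C (phi mu : predictor R x0) t :
  discrete_mixture C phi -> C mu -> (0 < t)%R -> (t < 1)%R ->
  exists psi : predictor R x0, discrete_mixture C psi /\
    forall A : set (seqspace x0), measurable A ->
      psi A = (1 - t)%:E * phi A + t%:E * mu A.
Proof.
move=> Cphi Cmu t0 t1.
(* All the weights have to be positive, hence [mu] occurs infinitely often. *)
pose nu_ k := if k is 0 then phi else mu.
pose v k := if k is k'.+1 then (t * telescoping_weight k')%R else (1 - t)%R.
have v0 k : (0 < v k)%R.
  by case: k => [|k] /=; rewrite ?subr_gt0// mulr_gt0// telescoping_weight_gt0.
have split_head (a : nat -> \bar R) : (forall k, 0 <= a k) ->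
    \sum_(0 <= k <oo) (v k)%:E * a k =
    (1 - t)%:E * a 0%N +
    t%:E * \sum_(0 <= k <oo) (telescoping_weight k)%:E * a k.+1.
  move=> a0; have va k : 0 <= (v k)%:E * a k by rewrite mule_ge0// lee_fin ltW.
  rewrite nneseries_recl//; congr (_ + _).
  rewrite -nneseriesZl => [|k _]; last first.
    by rewrite mule_ge0// lee_fin ltW// telescoping_weight_gt0.
  rewrite -(nneseries_addn 1%N)//.
  by apply: eq_eseriesr => k _; rewrite addn1 /= EFinM muleA.
have v1 : \sum_(0 <= k <oo) (v k)%:E = 1.
  transitivity (\sum_(0 <= k <oo) (v k)%:E * 1).
    by apply: eq_eseriesr => k _; rewrite mule1.
  rewrite (split_head (fun=> 1))//.
  under eq_eseriesr do rewrite mule1.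
  by rewrite telescoping_weight_sum !mule1 -EFinD subrK.
have [psi psiE] := mixture_exists nu_ (fun k => ltW (v0 k)) v1.
exists psi; split.
  apply: (@discrete_mixture_mixture C nu_ v) => // k; case: k => [|k] /=;
    [exact: Cphi|exact: discrete_mixture1].
move=> A mA; rewrite psiE (split_head (fun k => nu_ k A))//=.
by rewrite telescoping_weight_average ?fin_num_measure.
Qed.
End mixtures.

(** * From finite words to the asymptotic loss *)

Lemma limn_esup_le_perturb (R : realType) (u w : (\bar R)^nat) (e : R^nat) :
  (forall n, u n <= w n + (e n)%:E) -> e @ \oo --> (0 : R)%R ->
  limn_esup u <= limn_esup w.
Proof.
move=> uwe e0; rewrite /limn_esup [leRHS]limf_esupE.
apply: le_ereal_inf_tmp => _ [V Vnbhs <-].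
apply/lee_addgt0Pr => eps eps0.
have enbhs : \forall n \near \oo, (e n <= eps)%R.
  have /(_ _ _ eps0) := cvgr_lt (0 : R)%R e0.
  by apply: filterS => n; exact: ltW.
apply: (@le_trans _ _ (ereal_sup (u @` (V `&` [set n | e n <= eps]%R)))).
  apply: ereal_inf_lbound; exists (V `&` [set n | e n <= eps]%R) => //.
  exact: filterI.
apply: ge_ereal_sup => _ [n [Vn en] <-].
apply: le_trans (uwe n) _; apply: leeD; last by rewrite lee_fin.
by apply: ereal_sup_ubound; exists n.
Qed.

Section predictors.
Context (R : realType) (X : finType) (x0 : X).
Implicit Types (mu rho phi : predictor R x0) (C : set (predictor R x0)).

Lemma measurable_cylinder n (x : n.-tuple X) :
  measurable (cylinder x0 x : set (seqspace x0)).
Proof. by apply: sub_sigma_algebra; exists n, x. Qed.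
Hint Resolve measurable_cylinder : core.

Lemma word_probE mu n (x : n.-tuple X) :
  mu (cylinder x0 x) = (word_prob mu x)%:E.
Proof. by rewrite /word_prob fineK// fin_num_measure. Qed.

Lemma word_prob_itv mu n (x : n.-tuple X) : (0 <= word_prob mu x <= 1)%R.
Proof.
by rewrite -!lee_fin -word_probE measure_ge0 probability_le1.
Qed.

Lemma word_prob_ge0 mu n (x : n.-tuple X) : (0 <= word_prob mu x)%R.
Proof. by case/andP: (word_prob_itv mu x). Qed.

Lemma word_prob_sum1 mu n : (\sum_(x : n.-tuple X) word_prob mu x = 1)%R.
Proof.
have cover : \bigcup_(x in [set` enum {: n.-tuple X}])
    (cylinder x0 x : set (seqspace x0)) = setT.
  rewrite -subTset => w _; exists [tuple w i | i < n] => /=.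
    by rewrite mem_enum.
  by move=> i; rewrite tnth_mktuple.
apply: EFin_inj; rewrite -sumEFin.
under eq_bigr do rewrite -word_probE.
rewrite -big_enum/= fsbig_seq ?enum_uniq// -measure_fin_bigcup//.
- by rewrite cover; exact: (probability_setT mu).
- move=> x y _ _ [w [/= wx wy]]; apply: eq_from_tnth => i.
  by rewrite -wx -wy.
Qed.

(** The square root stands for any excess that is negligible against [n]; it
covers both bounded and logarithmic ones. *)
Lemma loss_le_sqrt mu rho phi (K : R) : (0 <= K)%R ->
  (forall n, kl_div n mu phi <=
     kl_div n mu rho + (K * Num.sqrt n.+1%:R)%:E) ->
  loss mu phi <= loss mu rho.
Proof.
move=> K0 kl_le.
apply: (@limn_esup_le_perturb _ _ _ (fun n => 2 * K * Num.sqrt n.+1%:R^-1)%R).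
  move=> n; apply: (@le_trans _ _ ((n%:R^-1)%:E *
      (kl_div n mu rho + (K * Num.sqrt n.+1%:R)%:E))).
    by rewrite lee_wpmul2l// lee_fin.
  rewrite muleDr ?fin_num_adde_defl// -EFinM leeD2l// lee_fin.
  set y : R := n.+1%:R; set s := Num.sqrt y.
  have y0 : (0 < y)%R by rewrite ltr0n.
  have s0 : (0 < s)%R by rewrite sqrtr_gt0.
  rewrite sqrtrV ?(ltW y0)// -/s mulrCA -[leRHS]mulrA [leRHS]mulrCA.
  rewrite ler_wpM2l// ler_pdivlMr// -mulrA -expr2 sqr_sqrtr ?(ltW y0)//.
  (* At [n = 0] the averaging factor is [0^-1 = 0]. *)
  case: n @y @s y0 s0 => [|n] y s y0 s0; first by rewrite invr0 mul0r.
  rewrite mulrC ler_pdivrMr ?ltr0n// /y -!natrM ler_nat.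
  by rewrite mul2n -addnn addnS addSn !ltnS leq_addl.
rewrite -[X in _ --> X](mulr0 (2 * K)%R); apply: cvgM; first exact: cvg_cst.
rewrite -[X in _ --> X](@sqrtr0 R).
apply: continuous_cvg; first exact: sqrt_continuous.
exact: cvg_harmonic.
Qed.

Lemma loss_le_ratio mu rho phi (K : R) : (0 <= K)%R ->
  (forall n (x : n.-tuple X), 0 < word_prob mu x -> 0 < word_prob rho x ->
     0 < word_prob phi x)%R ->
  (forall n, \sum_(x : n.-tuple X)
     word_prob mu x * word_prob rho x / word_prob phi x <=
       expR (K * Num.sqrt n.+1%:R))%R ->
  loss mu phi <= loss mu rho.
Proof.
move=> K0 pos ratio.
have ln2 : (0 < ln 2 :> R)%R by rewrite ln_gt0// ltr1n.
apply: (@loss_le_sqrt _ _ _ (K / ln 2)%R) => [|n].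
  by rewrite divr_ge0// ltW.
rewrite mulrAC -[in leRHS](expRK (K * _)%R).
apply: kl_sum_le => //; do ?[by move=> x; exact: word_prob_ge0].
- exact: word_prob_sum1.
- exact: pos.
- exact: expR_gt0.
Qed.

Lemma loss_le_dominated mu rho phi (w : R) : (0 < w)%R ->
  (forall n (x : n.-tuple X), w * word_prob rho x <= word_prob phi x)%R ->
  loss mu phi <= loss mu rho.
Proof.
move=> w0 dom; apply: (@loss_le_ratio _ _ _ w^-1%R) => [|n x mx rx|n].
- by rewrite invr_ge0 ltW.
- by apply: lt_le_trans (dom n x); rewrite mulr_gt0.
apply: (@le_trans _ _ w^-1%R).
  rewrite -[leRHS]mul1r -(word_prob_sum1 mu n) mulr_suml; apply: ler_sum => x _.
  rewrite -mulrA ler_wpM2l ?word_prob_ge0//.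
  have [rx|] := ltP 0%R (word_prob rho x).
    have px : (0 < word_prob phi x)%R.
      by apply: lt_le_trans (dom n x); rewrite mulr_gt0.
    by rewrite ler_pdivrMr// ler_pdivlMl.
  move=> rx; have /eqP -> : word_prob rho x == 0%R.
    by rewrite eq_le rx word_prob_ge0.
  by rewrite mul0r invr_ge0 ltW.
apply: (@le_trans _ _ (expR w^-1%R)).
  by apply: le_trans (expR_ge1Dx _); lra.
rewrite ler_expR ler_peMr ?invr_ge0 ?(ltW w0)//.
by rewrite -[leLHS]sqrtr1 ler_wsqrtr// ler1n.
Qed.

Lemma word_prob_mixture_ge phi (phi_ : nat -> predictor R x0) (v : nat -> R) :
  (forall k, 0 <= v k)%R ->
  (forall A, phi A = \sum_(0 <= k <oo) (v k)%:E * phi_ k A) ->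
  forall k n (x : n.-tuple X),
    (v k * word_prob (phi_ k) x <= word_prob phi x)%R.
Proof.
move=> v0 phiE k n x; rewrite -lee_fin EFinM -!word_probE phiE.
apply: (nneseries_term_le (a := fun k => (v k)%:E * phi_ k (cylinder x0 x))).
by move=> j; rewrite mule_ge0// lee_fin.
Qed.

(** The near-projection of [rho] for words of length [n]. *)
Lemma mixture_projection C rho n : C !=set0 ->
  exists phi, [/\ discrete_mixture C phi,
    forall mu (x : n.-tuple X), C mu -> (0 < word_prob mu x ->
      0 < word_prob rho x -> 0 < word_prob phi x)%R &
    forall mu, C mu -> (\sum_(x : n.-tuple X)
      word_prob mu x * word_prob rho x / word_prob phi x <= 7)%R].
Proof.
(* The convex set of near_projection is that of the marginals of all countable
   mixtures. *)
move=> [mu0 Cmu0].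
pose marg mu := fun x : n.-tuple X => word_prob mu x.
have [] := @near_projection R (n.-tuple X) (marg @` discrete_mixture C)
  (marg @` C) (marg rho).
- by move=> x; exact: word_prob_ge0.
- by rewrite word_prob_sum1.
- by exists (marg mu0), mu0 => //; exact: discrete_mixture1.
- by move=> _ x [mu _ <-]; exact: word_prob_itv.
- by move=> _ x [mu _ <-]; exact: word_prob_itv.
- move=> _ _ t [phi phiC <-] [mu Cmu <-] t0 t1.
  have [psi [psiC psiE]] := discrete_mixture_conv phiC Cmu t0 t1.
  exists psi => //; apply/funext => x; apply: EFin_inj.
  by rewrite -word_probE psiE// !word_probE -!EFinM -EFinD.
move=> _ [[phi phiC <-] pos le7]; exists phi; split=> //.
- by move=> mu x Cmu; apply: (pos (marg mu)); exists mu.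
- by move=> mu Cmu; apply: (le7 (marg mu)); exists mu.
Qed.

(** Weighting the projection for length [n] by [telescoping_weight n] makes one
mixture serve all lengths at a logarithmic cost. *)
Lemma mixture_dominates C rho : C !=set0 ->
  exists phi, discrete_mixture C phi /\
    forall mu, C mu -> loss mu phi <= loss mu rho.
Proof.
move=> C0.
have /choice[phi_ phi_P] := fun n => mixture_projection rho n C0.
have w0 k := ltW (@telescoping_weight_gt0 R k).
have [phi phiE] := mixture_exists phi_ w0 (telescoping_weight_sum R).
have phi_ge := word_prob_mixture_ge w0 phiE.
exists phi; split.
  apply: (discrete_mixture_mixture (phi_ := phi_)
    (v := telescoping_weight)) => //.
  - by move=> k; have [] := phi_P k.
  - exact: telescoping_weight_gt0.
  - exact: telescoping_weight_sum.
move=> mu Cmu.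
have pos n (x : n.-tuple X) : (0 < word_prob mu x -> 0 < word_prob rho x ->
    0 < telescoping_weight n * word_prob (phi_ n) x)%R.
  move=> mx rx; rewrite mulr_gt0 ?telescoping_weight_gt0//.
  by have [_ /(_ mu x Cmu) h _] := phi_P n; exact: h.
apply: (@loss_le_ratio _ _ _ 8) => // [n x mx rx|n].
  by apply: lt_le_trans (phi_ge n n x); exact: pos.
have [_ _ /(_ mu Cmu) le7] := phi_P n.
apply: (@le_trans _ _ (7 / telescoping_weight n)%R).
  rewrite ler_pdivlMr ?telescoping_weight_gt0//; apply: le_trans le7.
  rewrite mulr_suml; apply: ler_sum => x _.
  have [mx|mx] := ltP 0%R (word_prob mu x); last first.
    have /eqP -> : word_prob mu x == 0%R by rewrite eq_le mx word_prob_ge0.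
    by rewrite !mul0r.
  have [rx|rx] := ltP 0%R (word_prob rho x); last first.
    have /eqP -> : word_prob rho x == 0%R by rewrite eq_le rx word_prob_ge0.
    by rewrite mulr0 !mul0r.
  rewrite -!mulrA ler_pM2l// ler_pM2l//.
  have := pos n x mx rx; rewrite pmulr_rgt0 ?telescoping_weight_gt0// => px.
  have ge := phi_ge n n x.
  have phix : (0 < word_prob phi x)%R by apply: lt_le_trans ge; exact: pos.
  by rewrite mulrC ler_pdivrMr// mulrC ler_pdivlMr.
(* With [y = n + 1]: [7 / w_n = 7 * y * (y + 1) <= (2 * sqrt y) ^ 4]. *)
rewrite telescoping_weightE invrK.
set y : R := n.+1%:R; set s := Num.sqrt y.
have y1 : (1 <= y)%R by rewrite ler1n.
have sy : (s ^+ 2 = y)%R by rewrite sqr_sqrtr//; lra.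
have s0 : (0 <= s)%R by exact: sqrtr_ge0.
have -> : ((n.+1 * n.+2)%:R = y * (y + 1) :> R)%R.
  by rewrite natrM -[n.+2]addn1 natrD.
apply: (@le_trans _ _ ((2 * s) ^+ 4)%R).
  have -> : ((2 * s) ^+ 4 = 16 * (s ^+ 2) ^+ 2)%R by ring.
  by rewrite sy; nra.
have -> : (8 * s = 4%:R * (2 * s))%R by ring.
rewrite expRM_natl ler_pXn2r// ?nnegrE ?mulr_ge0 ?expR_ge0//.
by apply: le_trans (expR_ge1Dx _); lra.
Qed.

(** The mixture of a minimizing sequence loses, against each of its members, a
factor that does not depend on the length, which the averaging by [n] erases. *)
Lemma minimax_attained C : C !=set0 ->
  exists rho, forall mu, C mu -> loss mu rho <= minimax_loss C.
Proof.
move=> [mu0 Cmu0].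
have S0 : [set sup_loss C rho | rho in [set: predictor R x0]] != set0.
  by apply/set0P; exists (sup_loss C mu0), mu0.
have [u uS ucvg] := ereal_inf_seq S0.
have /choice[rho_ rho_P] : forall j, exists rho, sup_loss C rho = u j.
  by move=> j; have [rho _ <-] := uS j; exists rho.
have w0 k := ltW (@telescoping_weight_gt0 R k).
have [rho rhoE] := mixture_exists rho_ w0 (telescoping_weight_sum R).
exists rho => mu Cmu; apply: (cvge_ge _ ucvg); apply: nearW => j.
apply: (@le_trans _ _ (loss mu (rho_ j))).
  apply: (@loss_le_dominated _ _ _ (telescoping_weight j)).
    exact: telescoping_weight_gt0.
  exact: (word_prob_mixture_ge w0 rhoE).
by rewrite -rho_P; apply: ereal_sup_ubound; exists mu.
Qed.
End predictors.

(** * Optimality of mixtures *)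

Theorem theorem1 (R : realType) (X : finType) (x0 : X)
    (C : set (predictor R x0)) (C_neq0 : C !=set0) :
  (exists phi : predictor R x0,
     discrete_mixture C phi /\ sup_loss C phi = minimax_loss C) /\
  (forall rho : predictor R x0,
     exists phi : predictor R x0,
       discrete_mixture C phi /\
       (forall mu : predictor R x0, C mu -> loss mu phi <= loss mu rho)).
Proof.
split=> [|rho]; last exact: mixture_dominates.
have [rho rho_le] := minimax_attained C_neq0.
have [phi [phiC phi_le]] := mixture_dominates rho C_neq0.
exists phi; split=> //; apply/eqP; rewrite eq_le; apply/andP; split.
  apply: ge_ereal_sup => _ [mu Cmu <-].
  exact: le_trans (phi_le mu Cmu) (rho_le mu Cmu).
by apply: ereal_inf_lbound; exists phi.
Qed.
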